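(* Let $N\ge3$, let $\Omega=\mathbb{R}^N\setminus\mathcal{O}$ be a punctured or exterior domain with $\mathbb{R}^N\setminus B_e(0)\subset\Omega$, and let $h_1,h_2:\Omega\times[0,+\infty)\times[0,+\infty)\to\mathbb{R}$. Suppose there are nonnegative functions $\tilde h_1,\tilde h_2$ defined on $(\mathbb{R}^N\setminus B_e(0))\times[0,+\infty)\times[0,+\infty)$ with $$h_1(x,u,v)\ge\tilde h_1(x,u,v),\qquad h_2(x,u,v)\ge\tilde h_2(x,u,v)$$ for all $(x,u,v)\in(\mathbb{R}^N\setminus B_e(0))\times[0,+\infty)\times[0,+\infty)$, such that condition (a) holds, and such that either condition (b) holds or (if (b) fails) conditions (b1), (b2) and (b3) hold, where: (a) the maps $t\mapsto\tilde h_1(x,s,t)$ and $s\mapsto\tilde h_2(x,s,t)$ are nondecreasing, and for any $x\in\mathbb{R}^N\setminus B_e(0)$, $$\frac{\tilde h_1(x,s_1,t_1)}{s_1}\ge\frac{\tilde h_1(x,s_2,t_2)}{s_2}\quad\text{and}\quad\frac{\tilde h_2(x,s_1,t_1)}{t_1}\ge\frac{\tilde h_2(x,s_2,t_2)}{t_2}\quad\text{if } s_1\ge s_2>0,\ t_1\ge t_2>0;$$ (b) for any $t>0$, $$\liminf_{|x|\to+\infty}\tilde h_1(x,t|x|^{2-N},t|x|^{2-N})|x|^N>\frac{(N-2)^2}{4}\quad\text{or}\quad\liminf_{|x|\to+\infty}\tilde h_2(x,t|x|^{2-N},t|x|^{2-N})|x|^N>\frac{(N-2)^2}{4};$$ (b1)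 there exist positive constants $\sigma_3,\sigma_4$ with either $\sigma_3<1$ or $\sigma_4<1$ such that for any $t>0$, $$\liminf_{|x|\to+\infty}\tilde h_i(x,t|x|^{2-N},t|x|^{2-N})|x|^N(\ln|x|)^{\sigma_{i+2}}>0,\quad i=1,2;$$ (b2) (with $\sigma_3,\sigma_4$ from (b1)) if $\sigma_3<1$ and $\sigma_4\ge1$, there exists $\sigma_5>0$ such that for any $t>0$, $$\liminf_{|x|\to+\infty}\frac{\tilde h_1(x,t|x|^{2-N}(\ln|x|)^{\sigma_5},t|x|^{2-N})}{t|x|^{-N}(\ln|x|)^{\sigma_5}}>\frac{(N-2)^2}{4};$$ if $\sigma_3\ge1$ and $\sigma_4<1$, there exists $\sigma_6>0$ such that for any $t>0$, $$\liminf_{|x|\to+\infty}\frac{\tilde h_2(x,t|x|^{2-N},t|x|^{2-N}(\ln|x|)^{\sigma_6})}{t|x|^{-N}(\ln|x|)^{\sigma_6}}>\frac{(N-2)^2}{4};$$ (b3) (with $\sigma_3,\sigma_4$ from (b1)) if $\sigma_3<1$ and $\sigma_4<1$, there exist $\sigma_5,\sigma_6>0$ such that for any $t>0$, $$\liminf_{|x|\to+\infty}\frac{\tilde h_1(x,t|x|^{2-N}(\ln|x|)^{\sigma_5},t|x|^{2-N}(\ln|x|)^{\sigma_6})}{t|x|^{-N}(\ln|x|)^{\sigma_5}}>\frac{(N-2)^2}{4}$$ or $$\liminf_{|x|\to+\infty}\frac{\tilde h_2(x,t|x|^{2-N}(\ln|x|)^{\sigma_5},t|x|^{2-N}(\ln|x|)^{\sigma_6})}{t|x|^{-N}(\ln|x|)^{\sigma_6}}>\frac{(N-2)^2}{4}.$$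 Then the system $$-\Delta u=h_1(x,u,v)\ \text{ in }\Omega,\qquad-\Delta v=h_2(x,u,v)\ \text{ in }\Omega,\qquad u,v\ge0\ \text{ on }\partial\Omega$$ has no positive supersolution.
   Context: $B_r(0)$ is the ball of radius $r$ centered at the origin ($e$ is Euler's number). A punctured or exterior domain is a set $\Omega=\mathbb{R}^N\setminus\mathcal{O}$ where $\mathcal{O}$ is a bounded, closed, smooth subset of $\mathbb{R}^N$; typical examples are $\mathbb{R}^N\setminus\{0\}$ and $\mathbb{R}^N\setminus\overline{B}_R(0)$. A pair $(u,v)\in C^2(\Omega)\times C^2(\Omega)$ is a positive supersolution of the system if $u(x)>0$, $v(x)>0$, $-\Delta u(x)\ge h_1(x,u(x),v(x))$ and $-\Delta v(x)\ge h_2(x,u(x),v(x))$ for all $x\in\Omega$. *)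

(* Defs.v *)
From HB Require Import structures.
From mathcomp Require Import all_boot all_order all_algebra.
From mathcomp Require Import all_classical all_reals all_analysis.

Set Implicit Arguments.
Unset Strict Implicit.
Unset Printing Implicit Defensive.

Import Order.TTheory GRing.Theory Num.Theory.
Import numFieldNormedType.Exports.

Local Open Scope classical_set_scope.
Local Open Scope ring_scope.

Section euclidean.
Context {R : realType} {N : nat}.
Implicit Types (x : 'rV[R]_N) (W U V O Omega : set 'rV[R]_N).

(* The library norm on 'rV[R]_N is the sup norm; it induces the same topology
   and the same bounded sets as this one. *)
Definition enorm x : R := Num.sqrt (\sum_(i < N) x 0 i ^+ 2).

Definition outside_ball (r : R) : set 'rV[R]_N := [set x | r <= enorm x].

Definition enorm_infty : set_system 'rV[R]_N :=
  filter_from setT (fun M : R => [set x | M < enorm x]).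

Definition liminf_infty (f : 'rV[R]_N -> R) : \bar R :=
  limf_einf (fun x => (f x)%:E) enorm_infty.

Definition liminf_gt (f : 'rV[R]_N -> R) (c : R) : Prop :=
  (c%:E < liminf_infty f)%E.

Definition partial (i : 'I_N) (f : 'rV[R]_N -> R) : 'rV[R]_N -> R :=
  fun x => 'D_(delta_mx 0 i) f x.

Definition laplacian (f : 'rV[R]_N -> R) : 'rV[R]_N -> R :=
  fun x => \sum_(i < N) partial i (partial i f) x.

(* C^k on W, meant for open W: only then does the pointwise condition
   {for x, continuous f} depend on the values of f on W alone. *)
Fixpoint Ck (k : nat) W (f : 'rV[R]_N -> R) : Prop :=
  (forall x, W x -> {for x, continuous f}) /\
  if k is k'.+1 then
    forall i : 'I_N,
      (forall x, W x -> derivable f x (delta_mx 0 i)) /\ Ck k' W (partial i f)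
  else True.

Definition smooth_map W (phi : 'rV[R]_N -> 'rV[R]_N) : Prop :=
  forall (k : nat) (j : 'I_N), Ck k W (fun x => phi x 0 j).

Definition diffeomorphism U V (phi psi : 'rV[R]_N -> 'rV[R]_N) : Prop :=
  [/\ open U /\ open V,
      smooth_map U phi /\ smooth_map V psi,
      (forall x, U x -> V (phi x) /\ psi (phi x) = x) &
      (forall y, V y -> U (psi y) /\ phi (psi y) = y)].

(* R^d x {0} if b is false, and [0, +oo[ x R^(d-1) x {0} if b is true. *)
Definition model_space (d : nat) (b : bool) : set 'rV[R]_N :=
  [set y | (forall k : 'I_N, (d <= k)%N -> y 0 k = 0) /\
           (b -> forall k : 'I_N, (k = 0 :> nat)%N -> 0 <= y 0 k)].

(* Embedded C^oo submanifolds of R^N, with or without boundary, of any dimension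
   from 0 to N: a point (d = 0) and a closed ball (d = N, b = true at the boundary)
   are both smooth. *)
Definition smooth_subset O : Prop :=
  forall p, O p ->
    exists U V phi psi d b,
      [/\ U p, diffeomorphism U V phi psi &
          forall x, U x -> (O x <-> model_space d b (phi x))].

Definition punctured_or_exterior_domain Omega : Prop :=
  exists O, [/\ bounded_set O, closed O, smooth_subset O & Omega = ~` O].

(* Functions on a subset of R^N, or of R^N x [0, +oo[ x [0, +oo[, are represented
   by total functions whose values off that subset play no role. *)
Definition nonlinearity := 'rV[R]_N -> R -> R -> R.
Implicit Types h g : nonlinearity.

(* The boundary condition u, v >= 0 is no separate requirement on a positive
   supersolution: u and v are functions on the open set Omega. *)
Definition positive_supersolution Omega h1 h2 (u v : 'rV[R]_N -> R) : Prop :=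
  [/\ Ck 2 Omega u, Ck 2 Omega v &
      forall x, Omega x ->
        [/\ 0 < u x, 0 < v x,
            - laplacian u x >= h1 x (u x) (v x) &
            - laplacian v x >= h2 x (u x) (v x)]].

Definition nonneg_minorant h g : Prop :=
  forall x s t, outside_ball (expR 1) x -> 0 <= s -> 0 <= t ->
    0 <= g x s t /\ g x s t <= h x s t.

Definition cond_a g1 g2 : Prop :=
  forall x, outside_ball (expR 1) x ->
    [/\ forall s t1 t2, 0 <= s -> 0 <= t1 -> t1 <= t2 -> g1 x s t1 <= g1 x s t2,
        forall t s1 s2, 0 <= t -> 0 <= s1 -> s1 <= s2 -> g2 x s1 t <= g2 x s2 t &
        forall s1 s2 t1 t2, s1 >= s2 -> s2 > 0 -> t1 >= t2 -> t2 > 0 ->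
          g1 x s1 t1 / s1 >= g1 x s2 t2 / s2 /\
          g2 x s1 t1 / t1 >= g2 x s2 t2 / t2].

Definition hardy_const : R := (N%:R - 2) ^+ 2 / 4.

(* t |x|^(2-N), for N >= 2 *)
Definition fund (t : R) x : R := t * enorm x ^- (N - 2).

(* t |x|^(2-N) (ln |x|)^sigma *)
Definition fund_log (t sigma : R) x : R := fund t x * ln (enorm x) `^ sigma.

Definition cond_b g1 g2 : Prop :=
  forall t : R, 0 < t ->
    liminf_gt (fun x => g1 x (fund t x) (fund t x) * enorm x ^+ N) hardy_const \/
    liminf_gt (fun x => g2 x (fund t x) (fund t x) * enorm x ^+ N) hardy_const.

Definition log_lower_bound g (sigma : R) : Prop :=
  forall t : R, 0 < t ->
    liminf_gt (fun x => g x (fund t x) (fund t x) * enorm x ^+ N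
                            * ln (enorm x) `^ sigma) 0.

Definition cond_b1 g1 g2 (sigma3 sigma4 : R) : Prop :=
  [/\ 0 < sigma3, 0 < sigma4, sigma3 < 1 \/ sigma4 < 1,
      log_lower_bound g1 sigma3 & log_lower_bound g2 sigma4].

Definition cond_b2 g1 g2 (sigma3 sigma4 : R) : Prop :=
  (sigma3 < 1 -> 1 <= sigma4 ->
    exists2 sigma5 : R, 0 < sigma5 & forall t : R, 0 < t ->
      liminf_gt (fun x => g1 x (fund_log t sigma5 x) (fund t x) /
          (t * enorm x ^- N * ln (enorm x) `^ sigma5)) hardy_const) /\
  (1 <= sigma3 -> sigma4 < 1 ->
    exists2 sigma6 : R, 0 < sigma6 & forall t : R, 0 < t ->
      liminf_gt (fun x => g2 x (fund t x) (fund_log t sigma6 x) /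
          (t * enorm x ^- N * ln (enorm x) `^ sigma6)) hardy_const).

Definition cond_b3 g1 g2 (sigma3 sigma4 : R) : Prop :=
  sigma3 < 1 -> sigma4 < 1 ->
  exists sigma5 sigma6 : R,
    [/\ 0 < sigma5, 0 < sigma6 & forall t : R, 0 < t ->
      liminf_gt (fun x => g1 x (fund_log t sigma5 x) (fund_log t sigma6 x) /
          (t * enorm x ^- N * ln (enorm x) `^ sigma5)) hardy_const \/
      liminf_gt (fun x => g2 x (fund_log t sigma5 x) (fund_log t sigma6 x) /
          (t * enorm x ^- N * ln (enorm x) `^ sigma6)) hardy_const].

End euclidean.

Arguments nonlinearity : clear implicits.

(* Main.v *)
Require Import Defs.
From mathcomp Require Import all_boot all_order all_algebra.
From mathcomp Require Import all_classical all_reals all_analysis.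
From mathcomp Require Import ring lra.
Import Order.TTheory GRing.Theory Num.Theory.
Import numFieldNormedType.Exports.
Local Open Scope classical_set_scope.
Local Open Scope ring_scope.

(** Everything rests on one pointwise maximum principle, used three times with
explicit radial barriers.

A radial function is written H(s) in the variable s = ln |x|, because then
|x|^2 Lap (H (ln |x|)) = H''(s) + (N - 2) H'(s) has constant coefficients.
Suppose u > 0 satisfies - |x|^2 Lap u >= q(s) u on an annulus, while
- (H'' + (N - 2) H') < q H wherever H > 0.  If H / u had a positive interior
maximum k, then k u - H(ln |x|) would have an interior minimum with value 0, so
its Laplacian would be nonnegative there; but the two inequalities make it
negative.  Hence H <= k u on the annulus as soon as this holds on its boundary
([radial_comparison]).  Working with H / u rather than H - u is what makes this
possible although q may be positive.

Write al = (N - 2) / 2, so that al^2 is the Hardy constant.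

- Lower barriers ([radial_lower_bound]).  With
  H = exp(- (N - 2) s) s^sigma - e exp(- al s), the second term decays more slowly
  than the first, so H is negative on large spheres and only the inner sphere
  matters; letting e tend to 0 gives u >= t |x|^(2-N) (ln |x|)^sigma.  For q = 0
  and sigma = 0 this is the classical bound u >= t |x|^(2-N) for positive
  superharmonic functions.  For q = c s^(-s3) with s3 < 1 it holds with every
  power sigma at once ([log_growth]).

- Hardy threshold ([no_supersolution_above_hardy]).  When q is a constant
  c > al^2, the barrier H = exp(- al s) cos(w (s - s0)) with al^2 + w^2 < c vanishes
  on both boundary spheres of an annulus and is positive at s0, so comparison with
  k = 0 is contradictory: no such u exists.

For the system, the monotonicity of the quotients turns lower bounds p <= u,
q <= v into the linear inequality - Lap u >= (g1(x,p,q) / p) u, and similarly for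
v.  Under (b) the bounds by t |x|^(2-N) already put one of the two potentials
above the Hardy threshold.  Under (b1) they give a potential c |x|^(-2) (ln |x|)^(-s3),
whence the logarithmic growth, and (b2), (b3) say exactly that with this growth a
potential passes the Hardy threshold. *)

Set Implicit Arguments.
Unset Strict Implicit.
Unset Printing Implicit Defensive.

(** * The Euclidean norm *)

Section EuclideanNorm.
Context {R : realType} {N : nat}.
Implicit Types (x : 'rV[R]_N) (i : 'I_N).

Lemma enorm_sqr x : enorm x ^+ 2 = \sum_(i < N) x 0 i ^+ 2.
Proof. by rewrite sqr_sqrtr// sumr_ge0// => i _; exact: sqr_ge0. Qed.

Lemma enorm_continuous : continuous (@enorm R N).
Proof.
move=> x; apply: continuous_comp; last exact: sqrt_continuous.
suff C r : {for x, continuous (fun y : 'rV[R]_N => \sum_(i <- r) y 0 i ^+ 2)}.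
  exact: C.
elim: r => [|i r IH].
  rewrite (_ : (fun _ => _) = cst 0); first exact: cst_continuous.
  by apply/funext => y; rewrite big_nil.
rewrite (_ : (fun _ => _) = (fun y : 'rV[R]_N => y 0 i ^+ 2) +
    (fun y : 'rV[R]_N => \sum_(i <- r) y 0 i ^+ 2)); last first.
  by apply/funext => y; rewrite big_cons.
apply: continuousD IH.
apply: (@continuous_comp _ _ _ (fun y : 'rV[R]_N => y 0 i) (fun z => z ^+ 2)).
  exact: coord_continuous.
exact: exprn_continuous.
Qed.

Lemma coord_le_enorm x i : `|x 0 i| <= enorm x.
Proof.
rewrite -sqrtr_sqr ler_wsqrtr//.
by rewrite (bigD1 i)//= lerDl sumr_ge0// => j _; exact: sqr_ge0.
Qed.

Lemma annulus_compact (a b : R) : compact [set x : 'rV[R]_N | a <= enorm x <= b].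
Proof.
apply: bounded_closed_compact.
  exists b; split; first exact: num_real.
  move=> M bM x /= /andP[_ xb].
  have xM : enorm x <= M by rewrite (le_trans xb)// ltW.
  rewrite [leLHS]/Num.norm /= mx_normrE; apply/bigmax_leP.
  split=> [|[k j] _ /=]; first exact: le_trans (sqrtr_ge0 _) xM.
  by rewrite ord1; apply: le_trans (coord_le_enorm _ _) xM.
rewrite (_ : [set x | _] = (@enorm R N) @^-1` `[a, b]); last first.
  by apply/seteqP; split=> x /=; rewrite in_itv.
by apply: closed_comp => [x _|]; [exact: enorm_continuous|exact: itv_closed].
Qed.

Lemma enorm_line x i (t : R) :
  enorm (x + t *: delta_mx 0 i) ^+ 2 = enorm x ^+ 2 + 2 * t * x 0 i + t ^+ 2.
Proof.
rewrite !enorm_sqr (bigD1 i)//= [in RHS](bigD1 i)//= !mxE !eqxx /= mulr1.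
rewrite (eq_bigr (fun j => x 0 j ^+ 2)); first by ring.
by move=> j /negPf ji; rewrite !mxE ji andbF mulr0 addr0.
Qed.

Lemma Ck_subset k (V W : set 'rV[R]_N) (f : 'rV[R]_N -> R) :
  V `<=` W -> Ck k W f -> Ck k V f.
Proof.
move=> VW; elim: k f => [|k IH] f [cf].
  by split=> // x /VW; exact: cf.
move=> df; split=> [x /VW|i]; first exact: cf.
by have [dfi ckf] := df i; split=> [x /VW|]; [exact: dfi|exact: IH].
Qed.

End EuclideanNorm.

(** * Differential calculus along coordinate lines *)

Section OneVariable.
Context {R : realType}.

(** The first derivative vanishes at the minimum; were the second one negative,
the first derivative would be negative just to the right of 0 and the mean value
theorem would push the function below its minimum. *)
Lemma second_derivative_test (f f1 : R -> R) (d : R) :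
  (\forall t \near (0 : R), is_derive (t : R) 1 f (f1 t)) -> is_derive (0:R) 1 f1 d ->
  (\forall t \near (0 : R), f 0 <= f t) -> 0 <= d.
Proof.
move=> /nbhs_ballP[e1 /= e10 df] df1 /nbhs_ballP[e2 /= e20 fmin].
pose e := Num.min e1 e2; have e0 : 0 < e by rewrite lt_min e10.
have B (t : R) : t \in `]-e, e[ -> `|0 - t| < e.
  by rewrite sub0r normrN in_itv/= -ltr_norml.
have df' (t : R) : t \in `]-e, e[ -> is_derive (t : R) 1 f (f1 t).
  by move=> /B te; apply: df; rewrite /ball/= (lt_le_trans te)// ge_min lexx.
have fmin' (t : R) : t \in `]-e, e[ -> f 0 <= f t.
  by move=> /B te; apply: fmin; rewrite /ball/= (lt_le_trans te)// ge_min lexx orbT.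
have i0 : 0 \in `]-e, e[ by rewrite in_itv/= oppr_lt0 e0.
have f10 : f1 0 = 0.
  have D0 : is_derive (0:R) 1 f 0.
    apply: (@derive1_at_min _ _ (-e) e) => //; first by rewrite ge0_cp// ltW.
    by move=> t /df' [].
  by have := df' _ i0 => D1; have [_ <-] := D1; have [_ ->] := D0.
rewrite leNgt; apply/negP => d0.
have /nbhs_ballP[e3 /= e30 neg] : \forall h \near (0:R)^', h^-1 * f1 h < 0.
  have [+ dE] := df1; rewrite /derivable/= => cv.
  have : h^-1 *: ((f1 \o shift 0) (h *: (1:R)) - f1 0) @[h --> 0^'] --> d.
    by rewrite -dE; exact: cv.
  move=> /cvgr_lt/(_ _ d0); apply: filterS => h /=.
  by rewrite f10 subr0 addr0 [h%:A]mulr1.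
have [t [t0 te te3]] : exists t : R, [/\ 0 < t, t < e & t < e3].
  have m0 : 0 < Num.min e e3 by rewrite lt_min e0.
  exists (Num.min e e3 / 2); rewrite divr_gt0//.
  have : Num.min e e3 / 2 < Num.min e e3 by rewrite ltr_pdivrMr// ltr_pMr// ltr1n.
  by rewrite lt_min => /andP[].
have sub (s : R) : 0 <= s -> s <= t -> s \in `]-e, e[.
  by move=> s0 st; rewrite in_itv/= (lt_le_trans _ s0) ?oppr_lt0//= (le_lt_trans st).
have df_in (s : R) : s \in `]0, t[%R -> is_derive s 1 f (f1 s).
  by rewrite in_itv/= => /andP[s0 st]; apply: df'; apply: sub; exact: ltW.
have cf : {within `[0, t], continuous f}.
  apply: derivable_within_continuous => s; rewrite in_itv/= => /andP[s0 st].
  by have [] := df' s (sub _ s0 st).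
have [c cI E] := MVT t0 df_in cf.
move: cI; rewrite in_itv/= => /andP[c0 ct].
have : f1 c < 0.
  have := neg c; rewrite /ball/= sub0r normrN gtr0_norm// => /(_ (lt_trans ct te3)).
  by rewrite gt_eqF// => /(_ isT); rewrite pmulr_rlt0// invr_gt0.
have := fmin' t (sub _ (ltW t0) (lexx _)); rewrite -subr_ge0 E subr0.
by rewrite pmulr_lge0// leNgt => /negP.
Qed.

End OneVariable.

Section Lines.
Context {R : realType}.
Implicit Types (f g : R -> R) (x a b k : R).

(** Differentiation rules in pointwise form: the functions are displayed as
lambda-terms, so that they unify with explicit expressions. *)
Lemma der_cst k x : is_derive x 1 (fun=> k) 0.
Proof. exact: is_derive_cst. Qed.

Lemma der_id x : is_derive x 1 (fun t : R => t) 1.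
Proof. exact: is_derive_id. Qed.

Lemma derD f g x a b : is_derive x 1 f a -> is_derive x 1 g b ->
  is_derive x 1 (fun t => f t + g t) (a + b).
Proof. exact: is_deriveD. Qed.

Lemma derM f g x a b : is_derive x 1 f a -> is_derive x 1 g b ->
  is_derive x 1 (fun t => f t * g t) (a * g x + f x * b).
Proof.
move=> fa gb; have D := is_deriveM fa gb.
by apply: is_derive_eq D _; rewrite addrC /GRing.scale/= mulrC.
Qed.

Lemma derZ k f x a : is_derive x 1 f a -> is_derive x 1 (fun t => k * f t) (k * a).
Proof. by move=> fa; have := derM (der_cst k x) fa; rewrite mul0r add0r. Qed.

Lemma der_comp f g x a b : is_derive (g x) 1 f a -> is_derive x 1 g b ->
  is_derive x 1 (fun t => f (g t)) (a * b).
Proof. exact: is_derive1_comp. Qed.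

Lemma derB f g x a b : is_derive x 1 f a -> is_derive x 1 g b ->
  is_derive x 1 (fun t => f t - g t) (a - b).
Proof. exact: is_deriveB. Qed.

Lemma der_eq f x a b : is_derive x 1 f a -> a = b -> is_derive x 1 f b.
Proof. by move=> ? <-. Qed.

Lemma is_derive_line (N : nat) (f : 'rV[R]_N -> R) (x : 'rV[R]_N) (i : 'I_N) (t : R) :
  derivable f (x + t *: delta_mx 0 i) (delta_mx 0 i) ->
  is_derive t 1 (fun t : R => f (x + t *: delta_mx 0 i))
    (partial i f (x + t *: delta_mx 0 i)).
Proof.
move=> df.
have E : (fun h : R => h^-1 *:
    (((fun t => f (x + t *: delta_mx 0 i)) \o shift t) (h *: (1 : R))
    - f (x + t *: delta_mx 0 i))) =
  (fun h => h^-1 *: ((f \o shift (x + t *: delta_mx 0 i)) (h *: delta_mx 0 i)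
    - f (x + t *: delta_mx 0 i))).
  apply/funext => h /=; congr (_ *: (f _ - _)).
  by rewrite [h%:A]mulr1 scalerDl addrCA.
split; first by rewrite /derivable E.
by rewrite /derive E.
Qed.

(** Along x + t e_i the squared norm is q(t) = |x|^2 + 2 t x_i + t^2, so a function
of ln |x| restricts to H (ln (q t) / 2); below c stands for |x|^2 and p for x_i. *)
Section LogOfQuadratic.
Variables (c p : R).
Let q (t : R) := c + 2 * t * p + t ^+ 2.

Lemma is_derive_quadratic (t : R) : is_derive t 1 q (2 * (p + t)).
Proof.
rewrite (_ : q = fun t => (c + (2 * p) * t) + t * t); last first.
  by apply/funext => s; rewrite /q; ring.
have := derD (derD (der_cst c t) (derZ (2 * p) (der_id t))) (derM (der_id t) (der_id t)).
by move/der_eq; apply; ring.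
Qed.

Lemma is_derive_log_quadratic (t : R) : 0 < q t ->
  is_derive t 1 (fun t => ln (q t) / 2) ((p + t) / q t).
Proof.
move=> qt; have := derM (der_comp (is_derive1_ln qt) (is_derive_quadratic t))
  (der_cst 2^-1 t).
by move/der_eq; apply; field; rewrite gt_eqF.
Qed.

Lemma is_derive_radial (H : R -> R) (h t : R) : 0 < q t ->
  is_derive (ln (q t) / 2) 1 H h ->
  is_derive t 1 (fun t => H (ln (q t) / 2)) (h * ((p + t) / q t)).
Proof. move=> qt DH.
exact: (der_comp (g := fun t => ln (q t) / 2) DH (is_derive_log_quadratic qt)). Qed.

Lemma is_derive2_radial (H1 : R -> R) (h2 : R) : 0 < c ->
  is_derive (ln c / 2) 1 H1 h2 ->
  is_derive (0 : R) 1 (fun t => H1 (ln (q t) / 2) * ((p + t) / q t))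
    (h2 * (p ^+ 2 / c ^+ 2) + H1 (ln c / 2) * (c^-1 - 2 * (p ^+ 2 / c ^+ 2))).
Proof.
move=> c0 DH.
have q0 : q 0 = c by rewrite /q; ring.
have D1 : is_derive (0 : R) 1 (fun t => H1 (ln (q t) / 2)) (h2 * ((p + 0) / q 0)).
  by apply: is_derive_radial; rewrite q0.
have D3 : is_derive (0 : R) 1 (fun t => (q t)^-1) (- (q 0) ^- 2 *: (2 * (p + 0))).
  by apply: is_deriveV (is_derive_quadratic 0); rewrite q0 gt_eqF.
have := derM D1 (derM (derD (der_cst p 0) (der_id 0)) D3).
move/der_eq; apply; rewrite q0 /GRing.scale /=; field.
by rewrite gt_eqF.
Qed.

End LogOfQuadratic.
End Lines.

(** * The maximum principle for radial barriers *)

Section Comparison.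
Context {R : realType} {N : nat}.
Implicit Types (x : 'rV[R]_N) (u : 'rV[R]_N -> R).

Lemma ln_enorm_line x (i : 'I_N) (t : R) : 0 < enorm (x + t *: delta_mx 0 i) ->
  ln (enorm (x + t *: delta_mx 0 i)) =
  ln (enorm x ^+ 2 + 2 * t * x 0 i + t ^+ 2) / 2.
Proof. by move=> y0; rewrite -enorm_line lnXn// mulr2n; field. Qed.

Lemma expR1_lt_enorm x : (1 < ln (enorm x)) = (expR 1 < enorm x).
Proof.
have [x0|x0] := ltP 0 (enorm x).
  by rewrite -[in RHS](lnK x0) ltr_expR.
rewrite ln0// ltr10; apply/esym/negP => /lt_le_trans/(_ x0).
by rewrite ltNge expR_ge0.
Qed.

Lemma expR1_le_enorm x : (1 <= ln (enorm x)) = (expR 1 <= enorm x).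
Proof.
have [x0|x0] := ltP 0 (enorm x).
  by rewrite -[in RHS](lnK x0) ler_expR.
rewrite ln0// ler10; apply/esym/negP => /le_trans/(_ x0).
by rewrite leNgt expR_gt0.
Qed.

(** Second derivative test for k u - H(ln |.|) in every coordinate direction.  The
second derivative of H(ln |.|) along e_i at x is
H'' x_i^2 / |x|^4 + H' (1 / |x|^2 - 2 x_i^2 / |x|^4); summed over i and multiplied
by |x|^2 this is H'' + (N - 2) H'. *)
Lemma touching_laplacian u (H H1 H2 : R -> R) (k : R) x :
  Ck 2 (outside_ball (expR 1)) u -> 1 < ln (enorm x) ->
  (forall s : R, 0 < s -> is_derive s 1 H (H1 s)) ->
  (forall s : R, 0 < s -> is_derive s 1 H1 (H2 s)) ->
  (\forall y \near x, H (ln (enorm y)) <= k * u y) ->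
  H (ln (enorm x)) = k * u x ->
  H2 (ln (enorm x)) + (N%:R - 2) * H1 (ln (enorm x)) <=
    k * laplacian u x * enorm x ^+ 2.
Proof.
move=> [_ du] lx dH dH1 Hle Heq.
have x_gt : expR 1 < enorm x by rewrite -expR1_lt_enorm.
have x0 : 0 < enorm x by exact: lt_trans (expR_gt0 _) x_gt.
set c := enorm x ^+ 2.
have c0 : 0 < c by rewrite exprn_gt0.
have lnc : ln c / 2 = ln (enorm x) by rewrite /c lnXn// mulr2n; field.
pose d i := k * partial i (partial i u) x -
  (H2 (ln (enorm x)) * (x 0 i ^+ 2 / c ^+ 2)
   + H1 (ln (enorm x)) * (c^-1 - 2 * (x 0 i ^+ 2 / c ^+ 2))).
have d_ge0 i : 0 <= d i.
  have [dui [_ d2ui]] := du i; have [d2u _] := d2ui i.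
  pose y (t : R) := x + t *: delta_mx 0 i.
  pose q (t : R) := c + 2 * t * x 0 i + t ^+ 2.
  have y0 : y 0 = x by rewrite /y scale0r addr0.
  have cvy : y @ (0 : R) --> x.
    rewrite -[X in _ --> X]y0; apply: cvgD; first exact: cvg_cst.
    by apply: cvgZr_tmp; exact: cvg_id.
  have far : \forall t \near (0 : R), expR 1 < enorm (y t).
    have c1 : enorm (y t) @[t --> (0 : R)] --> enorm x.
      apply: (@continuous_cvg _ _ _ _ _ y (@enorm R N)) cvy.
      exact: enorm_continuous.
    exact: (cvgr_gt _ c1 _ x_gt).
  have below : \forall t \near (0 : R), H (ln (enorm (y t))) <= k * u (y t).
    exact: cvy Hle.
  have du0 : is_derive (0 : R) 1 (fun t => partial i u (y t))
      (partial i (partial i u) x).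
    rewrite -{1}y0; apply: is_derive_line.
    by apply: d2u; rewrite -/(y 0) y0 /outside_ball/= ltW.
  apply: (@second_derivative_test _ (fun t => k * u (y t) - H (ln (q t) / 2))
    (fun t => k * partial i u (y t) - H1 (ln (q t) / 2) * ((x 0 i + t) / q t))).
  - near=> t.
    have yt : expR 1 < enorm (y t) by near: t.
    have yt0 : 0 < enorm (y t) by exact: lt_trans (expR_gt0 _) yt.
    have qt : 0 < q t by rewrite /q /c -enorm_line exprn_gt0.
    apply: derB.
      by apply/derZ/is_derive_line/dui/ltW.
    apply: is_derive_radial => //; apply: dH.
    by rewrite /q /c -ln_enorm_line// (lt_trans _ (_ : 1 < _))// expR1_lt_enorm.
  - apply: (derB (derZ k du0)).
    rewrite -lnc; apply: is_derive2_radial => //.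
    by rewrite lnc; apply: dH1; exact: lt_trans lx.
  - near=> t.
    have yt : expR 1 < enorm (y t) by near: t.
    have yt0 : 0 < enorm (y t) by exact: lt_trans (expR_gt0 _) yt.
    have -> : q 0 = c by rewrite /q; ring.
    rewrite lnc y0 Heq subrr /q /c -ln_enorm_line// subr_ge0.
    by near: t.
have : 0 <= \sum_(i < N) d i by apply: sumr_ge0.
have -> : \sum_(i < N) d i = k * laplacian u x -
    (H2 (ln (enorm x)) + (N%:R - 2) * H1 (ln (enorm x))) / c.
  rewrite /d sumrB -mulr_sumr; congr (_ - _).
  rewrite big_split/= -!mulr_sumr sumrB -!mulr_sumr -!mulr_suml -enorm_sqr -/c.
  rewrite sumr_const card_ord -mulr_natl; field.
  by rewrite gt_eqF.
by rewrite subr_ge0 ler_pdivrMr.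
Unshelve. all: by end_near. Qed.

(** The constant k dominates on the boundary.  If the maximum of H / u over the
annulus exceeds k, it is positive and interior, and [touching_laplacian] applies
there with the maximum itself as multiplier. *)
Lemma radial_comparison u (H H1 H2 q : R -> R) (a b k : R) :
  Ck 2 (outside_ball (expR 1)) u -> 1 <= a ->
  (forall s : R, 0 < s -> is_derive s 1 H (H1 s)) ->
  (forall s : R, 0 < s -> is_derive s 1 H1 (H2 s)) ->
  (forall x, a <= ln (enorm x) <= b -> 0 < u x) ->
  (forall x, a < ln (enorm x) < b ->
     q (ln (enorm x)) * u x <= - laplacian u x * enorm x ^+ 2) ->
  (forall s : R, a < s < b -> 0 < H s ->
     - (H2 s + (N%:R - 2) * H1 s) < q s * H s) ->
  0 <= k ->
  (forall x, ln (enorm x) = a \/ ln (enorm x) = b ->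
     H (ln (enorm x)) <= k * u x) ->
  forall x, a <= ln (enorm x) <= b -> H (ln (enorm x)) <= k * u x.
Proof.
move=> uC a1 dH dH1 u0 supu subH k0 bdry x xab.
(* A closed annulus for the Euclidean norm, hence compact. *)
pose A : set 'rV[R]_N := [set x | a <= ln (enorm x) <= b].
have ln_pos y : A y -> 0 < enorm y.
  move=> /andP[ay _]; apply: lt_le_trans (expR_gt0 1) _.
  by rewrite -expR1_le_enorm (le_trans a1).
have Ae : A = [set x | expR a <= enorm x <= expR b].
  apply/seteqP; split=> y /=.
    move=> yA; have y0 := ln_pos _ yA.
    by move: yA; rewrite /A/= -{3 4}(lnK y0) !ler_expR.
  move=> yab; have y0 : 0 < enorm y.
    by case/andP: yab => ay _; apply: lt_le_trans (expR_gt0 a) ay.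
  by move: yab; rewrite -{1 2}(lnK y0) !ler_expR.
have cA : compact A by rewrite Ae; exact: annulus_compact.
pose f y := H (ln (enorm y)) / u y.
have cf : {within A, continuous f}.
  apply: continuous_in_subspaceT => y; rewrite inE => yA.
  have y0 := ln_pos _ yA.
  have ly0 : 0 < ln (enorm y).
    by case/andP: yA => ay _; rewrite (lt_le_trans _ ay)// (lt_le_trans _ a1).
  have cH : {for y, continuous (fun y : 'rV[R]_N => H (ln (enorm y)))}.
    apply: (@continuous_comp _ _ _ (@enorm R N) (fun r => H (ln r))).
      exact: enorm_continuous.
    apply: (@continuous_comp _ _ _ (@ln R) H); first exact: continuous_ln.
    by apply: differentiable_continuous; apply/derivable1_diffP; case: (dH _ ly0).
  have cu : {for y, continuous u}.
    case: uC => uc _; apply: uc; rewrite /outside_ball/= -expR1_le_enorm.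
    by case/andP: yA => ay _; exact: le_trans ay.
  apply: (@cvgM _ _ (nbhs y) _ _ _ _ _ cH).
  by apply: cvgV cu; rewrite gt_eqF// u0.
have [z /set_mem zA zmax] := compact_EVT_max (ex_intro _ x xab) cA cf.
have fle y : A y -> f y <= f z by move=> yA; apply: zmax; rewrite inE.
have Hle y : A y -> H (ln (enorm y)) <= f z * u y.
  by move=> yA; rewrite -ler_pdivrMr ?u0//; exact: fle.
have [fzk|kfz] := leP (f z) k.
  by apply: le_trans (Hle _ xab) _; rewrite ler_wpM2r// ltW// u0.
have uz := u0 _ zA.
have Hz : H (ln (enorm z)) = f z * u z by rewrite /f divfK// gt_eqF.
have zin : a < ln (enorm z) < b.
  case/andP: (zA) => az zb; rewrite !lt_neqAle az zb !andbT.
  have nb : ln (enorm z) = a \/ ln (enorm z) = b -> False.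
    by move=> /bdry; rewrite Hz ler_pM2r// leNgt kfz.
  by apply/andP; split; apply/eqP => E; apply: nb; [left|right].
have fz0 : 0 < f z by exact: le_lt_trans kfz.
have Hz0 : 0 < H (ln (enorm z)) by rewrite Hz mulr_gt0.
have near_A : \forall y \near z, A y.
  have lc : {for z, continuous (fun y : 'rV[R]_N => ln (enorm y))}.
    apply: (@continuous_comp _ _ _ (@enorm R N) (@ln R)).
      exact: enorm_continuous.
    by apply: continuous_ln; exact: ln_pos.
  case/andP: zin => az zb.
  near=> y; apply/andP; split; apply: ltW; near: y.
    exact: (cvgr_gt _ lc).
  exact: (cvgr_lt _ lc).
have := @touching_laplacian u H H1 H2 (f z) z uC.
move=> /(_ (le_lt_trans a1 (proj1 (andP zin))) dH dH1).
case/andP: (zin) => az zb.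
have nH : \forall y \near z, H (ln (enorm y)) <= f z * u y.
  by apply: filterS near_A => y; exact: Hle.
move=> /(_ nH Hz) lapl.
have := subH _ zin Hz0; rewrite Hz ltNge => /negP; case.
rewrite lerNr (le_trans lapl)//.
have := supu _ zin; rewrite -(ler_pM2l fz0).
by lra.
Unshelve. all: by end_near. Qed.

End Comparison.

(** * Derivatives and growth of the barrier profiles *)

Section Barriers.
Context {R : realType}.

(** Iterated, it gives the second derivative exp(- b s) (K'' - 2 b K' + b^2 K), on
which all the barriers are modelled. *)
Lemma der_expM (K K1 : R -> R) (b s : R) : is_derive s 1 K (K1 s) ->
  is_derive s 1 (fun s => expR (- b * s) * K s)
    (expR (- b * s) * (K1 s - b * K s)).
Proof.
move=> dK.
have dE := der_comp (g := fun s => - b * s) (is_derive_expR (- b * s))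
  (derZ (- b) (der_id s)).
by have := derM dE dK; move/der_eq; apply; ring.
Qed.

Lemma powR_le_expR (sigma al e s0 : R) : 0 < al -> 0 < e ->
  exists b, [/\ s0 <= b, 1 <= b & b `^ sigma <= e * expR (al * b)].
Proof.
move=> al0 e0; pose n := Num.bound `|sigma|.
have sn : sigma <= n%:R.
  by rewrite (le_trans (ler_norm _))// ltW// archi_boundP// normr_ge0.
pose C := n.+1`!%:R / (e * al ^+ n.+1).
pose b := Num.max s0 (Num.max 1 C).
have sb : s0 <= b by rewrite /b le_max lexx.
have b1 : 1 <= b by rewrite /b !le_max lexx orbT.
have Cb : C <= b by rewrite /b !le_max lexx !orbT.
have b0 : 0 < b by exact: lt_le_trans b1.
exists b; split => //.
apply: (@le_trans _ _ (b ^+ n)); first by rewrite -powR_mulrn ?(ltW b0)// ler_powR.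
have le1 := expR_ge1Dxn n (mulr_ge0 (ltW al0) (ltW b0)).
apply: (@le_trans _ _ (e * ((al * b) ^+ n.+1 / n.+1`!%:R))); last first.
  by rewrite ler_pM2l// (le_trans _ le1)// lerDr.
have f0 : 0 < n.+1`!%:R :> R by rewrite ltr0n fact_gt0.
have D0 : 0 < e * al ^+ n.+1 by rewrite mulr_gt0// exprn_gt0.
move: Cb; rewrite /C ler_pdivrMr// => Cb.
rewrite mulrA ler_pdivlMr// exprMn mulrA exprS.
have -> : e * al ^+ n.+1 * (b * b ^+ n) = b ^+ n * (b * (e * al ^+ n.+1)) by ring.
by rewrite ler_pM2l// exprn_gt0.
Qed.

Lemma der_powR (sigma s : R) : 0 < s ->
  is_derive s 1 (fun s => s `^ sigma) (sigma * (s `^ sigma / s)).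
Proof.
move=> s0; apply: (der_eq (is_derive1_powR sigma s0)).
by rewrite powRB ?powRr1// ?ltW//; apply/implyP => _; rewrite gt_eqF.
Qed.

Lemma der_powR1 (sigma s : R) : 0 < s ->
  is_derive s 1 (fun s => sigma * (s `^ sigma / s))
    (sigma * (sigma - 1) * (s `^ sigma / s ^+ 2)).
Proof.
move=> s0.
have dV : is_derive s 1 (fun s : R => s^-1) (- s ^- 2 *: 1).
  by apply: (is_deriveV (f := id)) (der_id s); rewrite gt_eqF.
have := derZ sigma (derM (der_powR sigma s0) dV).
move/der_eq; apply; rewrite /GRing.scale/=; field.
by rewrite gt_eqF.
Qed.

End Barriers.

(** * Positive supersolutions of linear equations outside a ball *)

Section Supersolutions.
Context {R : realType} {N : nat}.
Hypothesis N3 : (3 <= N)%N.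
Implicit Types (x : 'rV[R]_N).
Variable u : 'rV[R]_N -> R.
Hypothesis uC2 : Ck 2 (outside_ball (expR 1)) u.
Hypothesis u_gt0 : forall x, 1 <= ln (enorm x) -> 0 < u x.
(* al^2 is the Hardy constant; |x|^(2-N) is exp(- n s) and |x|^((2-N)/2) is
   exp(- al s) in the variable s = ln |x|. *)
Let n : R := N%:R - 2.
Let al : R := n / 2.

Lemma dim_sub2_gt0 : 0 < n.
Proof. by rewrite subr_gt0 (ltr_nat _ 2). Qed.

Lemma hardy_constE : hardy_const (R := R) (N := N) = al ^+ 2.
Proof. by rewrite /hardy_const /al /n; field. Qed.

Lemma exists_ln_enorm (s : R) : exists x, ln (enorm x) = s.
Proof.
exists (expR s *: delta_mx 0 (Ordinal (leq_trans (isT : 0 < 3)%N N3))).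
rewrite -[RHS]expRK; congr ln; set i := Ordinal _.
have := enorm_line (0 : 'rV[R]_N) i (expR s).
have -> : enorm (0 : 'rV[R]_N) ^+ 2 = 0.
  by rewrite enorm_sqr big1// => j _; rewrite mxE expr0n.
rewrite !add0r mxE mulr0 add0r => /eqP.
by rewrite eqrXn2 ?expR_ge0 ?sqrtr_ge0// => /eqP.
Qed.

Lemma enorm_gt0_of_ln x : 1 <= ln (enorm x) -> 0 < enorm x.
Proof. by rewrite expR1_le_enorm; apply: lt_le_trans; exact: expR_gt0. Qed.

(** Above the Hardy constant the equation H'' + n H' + c H = 0 oscillates.  The
frequency w is chosen with al^2 + w^2 strictly between al^2 and c; the half-period
of cos(w (s - s0)) around s0 starts at s = a. *)
Lemma no_supersolution_above_hardy (c a : R) : al ^+ 2 < c -> 1 <= a ->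
  (forall x, a < ln (enorm x) -> c * u x <= - laplacian u x * enorm x ^+ 2) ->
  False.
Proof.
move=> hc a1 supu.
pose w := Num.sqrt ((c - al ^+ 2) / 2).
have d0 : 0 < (c - al ^+ 2) / 2 by rewrite divr_gt0// subr_gt0.
have w0 : 0 < w by rewrite sqrtr_gt0.
have w2 : w ^+ 2 = (c - al ^+ 2) / 2 by rewrite sqr_sqrtr// ltW.
pose s0 := a + pi / 2 / w; pose b := s0 + pi / 2 / w.
have p0 : 0 < pi / 2 / w by rewrite !divr_gt0// pi_gt0.
pose K (s : R) := cos (w * (s - s0)).
pose K1 (s : R) := - w * sin (w * (s - s0)).
pose K2 (s : R) := - w ^+ 2 * K s.
have dl (s : R) : is_derive s 1 (fun s => w * (s - s0)) (w * (1 - 0)).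
  exact: (derZ w (derB (der_id s) (der_cst s0 s))).
have dK (s : R) : is_derive s 1 K (K1 s).
  have := der_comp (g := fun s => w * (s - s0)) (is_derive_cos _) (dl s).
  by move/der_eq; apply; rewrite /K1; ring.
have dK1 (s : R) : is_derive s 1 K1 (K2 s).
  have := derZ (- w) (der_comp (g := fun s => w * (s - s0)) (is_derive_sin _) (dl s)).
  by move/der_eq; apply; rewrite /K2 /K; ring.
pose H (s : R) := expR (- al * s) * K s.
pose H1 (s : R) := expR (- al * s) * (K1 s - al * K s).
pose H2 (s : R) := expR (- al * s) * ((K2 s - al * K1 s) - al * (K1 s - al * K s)).
have dH (s : R) : is_derive s 1 H (H1 s) by exact: der_expM (dK s).
have dH1 (s : R) : is_derive s 1 H1 (H2 s).
  have dKK := derB (dK1 s) (derZ al (dK s)).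
  exact: (der_expM (K := fun s : R => K1 s - al * K s)
    (K1 := fun s : R => K2 s - al * K1 s) al dKK).
have ab : a <= s0 <= b by rewrite /b /s0 !lerDl ltW.
have [z zs0] := exists_ln_enorm s0.
have Hz : 0 < H (ln (enorm z)).
  by rewrite zs0 /H /K subrr mulr0 cos0 mulr1 expR_gt0.
have : H (ln (enorm z)) <= 0 * u z.
  apply: (@radial_comparison _ _ u H H1 H2 (fun=> c) a b 0) => //.
  - by move=> x /andP[ax _]; apply: u_gt0; exact: le_trans ax.
  - by move=> x /andP[ax _]; exact: supu.
  - move=> s _ Hs.
    have -> : - (H2 s + (N%:R - 2) * H1 s) = (al ^+ 2 + w ^+ 2) * H s.
      have -> : N%:R - 2 = 2 * al by rewrite /al /n; field.
      by rewrite /H2 /H1 /H /K2; ring.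
    by rewrite ltr_pM2r// w2; lra.
  - move=> x; rewrite mul0r => -[->|->]; rewrite /H /K.
      have -> : w * (a - s0) = - (pi / 2).
        by rewrite /s0; field; rewrite gt_eqF.
      by rewrite cosN cos_pihalf mulr0.
    have -> : w * (b - s0) = pi / 2.
      by rewrite /b; field; rewrite gt_eqF.
    by rewrite cos_pihalf mulr0.
  - by rewrite zs0.
by rewrite mul0r leNgt Hz.
Qed.

Lemma sphere_lower_bound (a : R) : 1 <= a ->
  exists2 m, 0 < m & forall x, ln (enorm x) = a -> m <= u x.
Proof.
move=> a1; have [z za] := exists_ln_enorm a.
pose A : set 'rV[R]_N := [set x | expR a <= enorm x <= expR a].
have AE x : ln (enorm x) = a -> A x.
  move=> xa; have x0 : 0 < enorm x by apply: enorm_gt0_of_ln; rewrite xa.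
  by rewrite /A/= -xa lnK// lexx.
have EA x : A x -> ln (enorm x) = a.
  by rewrite /A/= => /le_anti <-; rewrite expRK.
have uA : {within A, continuous u}.
  apply: continuous_in_subspaceT => y; rewrite inE => /EA yA.
  by case: uC2 => uc _; apply: uc; rewrite /outside_ball/= -expR1_le_enorm yA.
have [y /set_mem yA ymin] :=
  compact_EVT_min (ex_intro _ z (AE _ za)) (@annulus_compact _ _ _ _) uA.
exists (u y); first by apply: u_gt0; rewrite EA.
by move=> x xa; apply: ymin; rewrite inE; exact: AE.
Qed.

(** The second hypothesis on q says that K = s^sigma satisfies n K' - K'' <= q K, that
is, exp(- n s) K is a subsolution; q < al^2 makes exp(- al s) a strict
supersolution, which yields the strictness needed for the comparison. *)
Lemma radial_lower_bound (sigma a : R) (q : R -> R) : 1 <= a ->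
  (forall s, a < s -> q s < al ^+ 2) ->
  (forall s, a < s -> n * sigma * s - sigma * (sigma - 1) <= q s * s ^+ 2) ->
  (forall x, a < ln (enorm x) ->
     q (ln (enorm x)) * u x <= - laplacian u x * enorm x ^+ 2) ->
  exists2 t, 0 < t & forall x, a <= ln (enorm x) ->
    t * (expR (- n * ln (enorm x)) * ln (enorm x) `^ sigma) <= u x.
Proof.
move=> a1 q_lt q_ge supu.
have al0 : 0 < al by rewrite divr_gt0// dim_sub2_gt0.
have a0 : 0 < a by exact: lt_le_trans a1.
have [m m0 um] := sphere_lower_bound a1.
pose H0 (s : R) := expR (- n * s) * s `^ sigma.
have H0_gt0 s : 0 < s -> 0 < H0 s by move=> s0; rewrite mulr_gt0 ?expR_gt0 ?powR_gt0.
have k0 : 0 < H0 a / m by rewrite divr_gt0 ?H0_gt0.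
exists (m / H0 a); first by rewrite divr_gt0 ?H0_gt0.
move=> x ax; rewrite -/(H0 _) mulrC -ler_pdivlMr ?divr_gt0 ?H0_gt0// invf_div mulrC.
have x0 : 0 < ln (enorm x) by exact: lt_le_trans ax.
apply/ler_addgt0Pr => e' e'0.
pose F (s : R) := expR (- al * s).
have F0 s : 0 < F s by exact: expR_gt0.
pose e := e' / F (ln (enorm x)).
have e0 : 0 < e by rewrite divr_gt0.
(* b is so large that the barrier is nonpositive on the outer sphere. *)
have [b [xb b1 bE]] := powR_le_expR sigma (ln (enorm x)) al0 e0.
rewrite -lerBlDr.
pose P (s : R) := s `^ sigma.
pose P1 (s : R) := sigma * (P s / s).
pose P2 (s : R) := sigma * (sigma - 1) * (P s / s ^+ 2).
pose H (s : R) := H0 s - e * F s.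
pose H1 (s : R) := expR (- n * s) * (P1 s - n * P s) - e * (F s * (- al)).
pose H2 (s : R) := expR (- n * s) * ((P2 s - n * P1 s) - n * (P1 s - n * P s))
   - e * (F s * al ^+ 2).
have dF (s : R) : is_derive s 1 F (F s * (- al)).
  have := der_comp (g := fun s => - al * s) (is_derive_expR (- al * s))
    (derZ (- al) (der_id s)).
  by move/der_eq; apply; rewrite mulr1.
have dF1 (s : R) : is_derive s 1 (fun s => F s * (- al)) (F s * al ^+ 2).
  by apply: (der_eq (derM (dF s) (der_cst (- al) s))); ring.
have dH (s : R) : 0 < s -> is_derive s 1 H (H1 s).
  move=> s0; have dE := der_expM (K := P) (K1 := P1) n (der_powR sigma s0).
  exact: (derB dE (derZ e (dF s))).
have dH1 (s : R) : 0 < s -> is_derive s 1 H1 (H2 s).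
  move=> s0.
  have dPP := derB (der_powR1 sigma s0) (derZ n (der_powR sigma s0)).
  have dE := der_expM (K := fun s : R => P1 s - n * P s)
    (K1 := fun s : R => P2 s - n * P1 s) n dPP.
  exact: (derB dE (derZ e (dF1 s))).
have -> : e' = e * F (ln (enorm x)) by rewrite /e divfK// gt_eqF.
apply: (@radial_comparison _ _ u H H1 H2 q a b (H0 a / m)) => //.
- by move=> y /andP[ay _]; apply: u_gt0; exact: le_trans ay.
- by move=> y /andP[ay _]; exact: supu.
- move=> s /andP[sa sb] _.
  have s0 : 0 < s by exact: lt_trans sa.
  have Ps : 0 < P s by exact: powR_gt0.
  have E0 : 0 < expR (- n * s) by exact: expR_gt0.
  have nE : n = 2 * al by rewrite /al; field.
  have -> : - (H2 s + (N%:R - 2) * H1 s) =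
      expR (- n * s) * (n * P1 s - P2 s) - e * F s * al ^+ 2.
    by rewrite /H2 /H1 -/n nE; ring.
  have A1 : n * P1 s - P2 s <= q s * P s.
    have -> : n * P1 s - P2 s =
      (n * sigma * s - sigma * (sigma - 1)) * (P s / s ^+ 2).
      by rewrite /P1 /P2; field; rewrite gt_eqF.
    have -> : q s * P s = (q s * s ^+ 2) * (P s / s ^+ 2) by field; rewrite gt_eqF.
    by rewrite ler_wpM2r ?q_ge// divr_ge0// ?ltW// exprn_gt0.
  have A2 : e * F s * q s < e * F s * al ^+ 2 by rewrite ltr_pM2l ?q_lt// mulr_gt0.
  have A3 : expR (- n * s) * (n * P1 s - P2 s) <= expR (- n * s) * (q s * P s).
    by rewrite ler_pM2l.
  have -> : q s * H s = expR (- n * s) * (q s * P s) - e * F s * q s.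
    by rewrite /H /H0 -/(P s); ring.
  by lra.
- exact: ltW.
- move=> y [ya|yb].
    apply: (@le_trans _ _ (H0 a)).
      by rewrite ya /H gerBl mulr_ge0// ltW.
    by rewrite -mulrA ler_peMr ?(ltW (H0_gt0 _ _))// mulrC ler_pdivlMr// mul1r um.
  have b0 : 0 < b by exact: lt_le_trans b1.
  apply: (@le_trans _ _ 0).
    rewrite yb /H subr_le0 /H0.
    have -> : F b = expR (- n * b) * expR (al * b).
      by rewrite -expRD /F; congr expR; rewrite /al; field.
    by rewrite mulrCA ler_pM2l ?expR_gt0.
  rewrite mulr_ge0// ?ltW// u_gt0// yb//.
- by rewrite ax xb.
Qed.

(** As s3 < 1, the potential c s^(-s3) eventually dominates the 1 / s needed to
sustain growth by any power of s. *)
Lemma log_growth (c s3 sigma a : R) : 0 < c -> 0 < s3 -> s3 < 1 -> 0 < sigma ->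
  1 <= a ->
  (forall x, a < ln (enorm x) ->
     c * ln (enorm x) `^ (- s3) * u x <= - laplacian u x * enorm x ^+ 2) ->
  exists2 a', 1 <= a' & exists2 t, 0 < t & forall x, a' <= ln (enorm x) ->
    t * (expR (- n * ln (enorm x)) * ln (enorm x) `^ sigma) <= u x.
Proof.
move=> c0 s30 s31 sig0 a1 supu.
have al0 : 0 < al by rewrite divr_gt0// dim_sub2_gt0.
have al20 : 0 < al ^+ 2 by rewrite exprn_gt0.
(* Lowering c keeps the potential below the Hardy constant for all s >= 1. *)
pose c' := Num.min c (al ^+ 2 / 2).
have c'0 : 0 < c' by rewrite lt_min c0 divr_gt0.
have c'c : c' <= c by rewrite ge_min lexx.
have c'al : c' < al ^+ 2.
  by rewrite (@le_lt_trans _ _ (al ^+ 2 / 2)) ?ge_min ?lexx ?orbT//; lra.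
(* C s bounds n sigma s - sigma (sigma - 1) for s >= 1. *)
pose C := n * sigma + sigma + sigma ^+ 2.
have C0 : 0 < C by rewrite /C !addr_gt0// ?mulr_gt0// ?dim_sub2_gt0// exprn_gt0.
have r0 : 0 < 1 - s3 by rewrite subr_gt0.
pose S := (C / c') `^ (1 - s3)^-1.
pose a' := Num.max a S.
have aa' : a <= a' by rewrite le_max lexx.
have Sa' : S <= a' by rewrite le_max lexx orbT.
have a'1 : 1 <= a' by exact: le_trans aa'.
exists a' => //.
apply: (@radial_lower_bound sigma a' (fun s => c' * s `^ (- s3))) => //.
- move=> s sa; apply: le_lt_trans c'al.
  rewrite ler_piMr// ?(ltW c'0)// powRN invf_le1 ?powR_gt0//; last first.
    by rewrite (lt_trans _ sa)// (lt_le_trans _ a'1).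
  have s1 : 1 <= s by rewrite (le_trans a'1)// ltW.
  by rewrite -[leLHS](powRr0 s) ler_powR// ltW.
- move=> s sa.
  have s1 : 1 <= s by rewrite (le_trans a'1)// ltW.
  have s0 : 0 < s by exact: lt_le_trans s1.
  apply: (@le_trans _ _ (C * s)).
    have h1 : sigma <= sigma * s by rewrite ler_peMr// ltW.
    have h2 : 0 <= sigma ^+ 2 by exact: sqr_ge0.
    have h3 : 0 <= sigma ^+ 2 * s by rewrite mulr_ge0// ltW.
    by rewrite /C; lra.
  have sE : c' * s `^ (- s3) * s ^+ 2 = c' * s `^ (1 - s3) * s.
    rewrite powRD; last by rewrite (gt_eqF s0) implybT.
    by rewrite powRr1 ?ltW//; ring.
  rewrite sE ler_pM2r// mulrC -ler_pdivrMr//.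
  have -> : C / c' = S `^ (1 - s3).
    by rewrite /S -powRrM mulVf ?gt_eqF// powRr1// divr_ge0// ltW.
  rewrite ge0_ler_powR ?nnegrE ?powR_ge0 ?ltW//.
  by rewrite (le_lt_trans Sa').
- move=> x ax; apply: le_trans (supu _ (le_lt_trans aa' ax)).
  rewrite ler_wpM2r//.
    by rewrite ltW// u_gt0// (le_trans a'1)// ltW.
  by rewrite ler_wpM2r ?powR_ge0.
Qed.

End Supersolutions.

(** * From the conditions at infinity to linear inequalities *)

Section Growth.
Context {R : realType} {N : nat}.
Hypothesis N3 : (3 <= N)%N.
Implicit Types (x : 'rV[R]_N) (t : R).

(** The strict inequality leaves room for a constant c' > c, and the bound |x| > M is
implied by ln |x| > M because ln r < r. *)
Lemma liminf_gt_near (f : 'rV[R]_N -> R) (c : R) : liminf_gt f c ->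
  exists c' a, [/\ c < c', 1 <= a & forall x, a < ln (enorm x) -> c' <= f x].
Proof.
rewrite /liminf_gt /liminf_infty limf_einfE => /ereal_sup_gt[_ [A [M _ MA] <-] cA].
have [c' cc' c'A] : exists2 c' : R, c < c' &
    (c'%:E <= ereal_inf ((fun x => (f x)%:E) @` A))%E.
  case: (ereal_inf _) cA => [r| |] //=.
    by rewrite lte_fin => cr; exists r.
  by move=> _; exists (c + 1); rewrite ?leey// ltrDl.
exists c', (Num.max 1 M); split=> //; first by rewrite le_max lexx.
move=> x; rewrite gt_max => /andP[x1 xM].
have x0 := enorm_gt0_of_ln (ltW x1).
rewrite -lee_fin (le_trans c'A)//; apply: ereal_inf_lbound.
by exists x => //; apply: MA; rewrite /= (lt_trans xM)// ln_sublinear.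
Qed.

Lemma enormXN x : enorm x ^+ N = enorm x ^+ (N - 2) * enorm x ^+ 2.
Proof. by rewrite -exprD subnK// ltnW. Qed.

Lemma fund_gt0 t x : 0 < t -> 0 < enorm x -> 0 < fund t x.
Proof. by move=> t0 x0; rewrite mulr_gt0// invr_gt0 exprn_gt0. Qed.

Lemma fund_log_gt0 t sigma x : 0 < t -> 1 <= ln (enorm x) -> 0 < fund_log t sigma x.
Proof.
move=> t0 x1; rewrite mulr_gt0 ?fund_gt0 ?enorm_gt0_of_ln// powR_gt0//.
exact: lt_le_trans x1.
Qed.

Lemma fund_logE t sigma x : 0 < enorm x -> fund_log t sigma x =
  t * (expR (- (N%:R - 2) * ln (enorm x)) * ln (enorm x) `^ sigma).
Proof.
move=> x0; rewrite /fund_log /fund -mulrA; congr (_ * (_ * _)).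
by rewrite mulNr expRN -(natrB _ (ltnW N3)) expRM_natl lnK.
Qed.

Lemma fund_log0 t x : fund_log t 0 x = fund t x.
Proof. by rewrite /fund_log powRr0 mulr1. Qed.

Lemma fund_log_le (t1 t2 sigma : R) x :
  t1 <= t2 -> fund_log t1 sigma x <= fund_log t2 sigma x.
Proof.
move=> t12; rewrite /fund_log /fund !ler_wpM2r ?powR_ge0//.
by rewrite invr_ge0 exprn_ge0// sqrtr_ge0.
Qed.

Lemma superharmonic_lower_bound (u : 'rV[R]_N -> R) :
  Ck 2 (outside_ball (expR 1)) u ->
  (forall x, 1 <= ln (enorm x) -> 0 < u x) ->
  (forall x, 1 <= ln (enorm x) -> 0 <= - laplacian u x) ->
  exists2 t, 0 < t & forall x, 1 <= ln (enorm x) -> fund t x <= u x.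
Proof.
move=> uC2 u_gt0 super.
have [||||t t0 tu] := @radial_lower_bound R N N3 u uC2 u_gt0 0 1 (fun=> 0).
- by [].
- by move=> s _; rewrite exprn_gt0// divr_gt0// dim_sub2_gt0.
- by move=> s _; rewrite mulr0 !mul0r subrr.
- by move=> x x1; rewrite mul0r mulr_ge0 ?exprn_ge0 ?sqrtr_ge0// super// ltW.
exists t => // x x1; rewrite -fund_log0 fund_logE ?tu//.
exact: enorm_gt0_of_ln.
Qed.

(** One equation of the system.  The hypothesis [superlinear] is the form in which
the monotonicity of the quotients is used; it treats both equations alike, with
(u, v, g) replaced by (v, u, g with its last two arguments exchanged). *)
Section Component.
Variables (u v : 'rV[R]_N -> R) (g : nonlinearity R N).
Hypothesis uC2 : Ck 2 (outside_ball (expR 1)) u.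
Hypothesis u_gt0 : forall x, 1 <= ln (enorm x) -> 0 < u x.
Hypothesis g_ge0 : forall x s t,
  1 <= ln (enorm x) -> 0 <= s -> 0 <= t -> 0 <= g x s t.
Hypothesis superlinear : forall x, 1 <= ln (enorm x) ->
  forall p q, 0 < p <= u x -> 0 < q <= v x ->
  g x p q / p * u x <= - laplacian u x.

Lemma absurd_of_hardy_liminf (f p q : 'rV[R]_N -> R) (a : R) : 1 <= a ->
  liminf_gt f (hardy_const (R := R) (N := N)) ->
  (forall x, a <= ln (enorm x) ->
    [/\ 0 < p x <= u x, 0 < q x <= v x &
        f x <= g x (p x) (q x) / p x * enorm x ^+ 2]) -> False.
Proof.
move=> a1 /liminf_gt_near[c [b [hc b1 fb]]] hyp.
apply: (@no_supersolution_above_hardy R N N3 u uC2 u_gt0 c (Num.max a b)).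
- by move: hc; rewrite hardy_constE.
- by rewrite le_max a1.
move=> x; rewrite gt_max => /andP[ax bx].
have x1 : 1 <= ln (enorm x) by rewrite (le_trans a1)// ltW.
have [pu qv fg] := hyp x (ltW ax).
have ux := u_gt0 x1.
apply: (@le_trans _ _ (f x * u x)); first by rewrite ler_pM2r// fb.
apply: (@le_trans _ _ (g x (p x) (q x) / p x * u x * enorm x ^+ 2)).
  by rewrite mulrAC ler_pM2r.
by rewrite ler_wpM2r ?superlinear// exprn_ge0// sqrtr_ge0.
Qed.

Variable t : R.
Hypothesis t0 : 0 < t.
Hypothesis fund_u : forall x, 1 <= ln (enorm x) -> fund t x <= u x.
Hypothesis fund_v : forall x, 1 <= ln (enorm x) -> fund t x <= v x.

(** The potential g / fund carries a factor 1 / t with respect to the quantity in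
the conditions at infinity. *)
Lemma quotient_fund x (y : R) : 1 <= ln (enorm x) ->
  y / fund t x * enorm x ^+ 2 = y * enorm x ^+ N / t.
Proof.
move=> x1; have x0 := enorm_gt0_of_ln x1.
have e0 : enorm x ^+ (N - 2) != 0 by rewrite gt_eqF// exprn_gt0.
by rewrite /fund enormXN; field; rewrite e0 gt_eqF.
Qed.

(** For t <= 1 the factor 1 / t only enlarges the potential, so the liminf above the
Hardy constant is inherited by it. *)
Lemma absurd_of_cond_b : t <= 1 ->
  liminf_gt (fun x => g x (fund t x) (fund t x) * enorm x ^+ N)
    (hardy_const (R := R) (N := N)) -> False.
Proof.
move=> t1 lim.
apply: (@absurd_of_hardy_liminf _ (fund t) (fund t) 1 _ lim) => // x x1.
have x0 := enorm_gt0_of_ln x1.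
have f0 := fund_gt0 t0 x0.
rewrite f0 fund_u// fund_v// quotient_fund//; split=> //.
rewrite ler_peMr ?invf_ge1// mulr_ge0 ?exprn_ge0 ?sqrtr_ge0//.
by rewrite g_ge0// ltW.
Qed.

Lemma log_growth_of_log_lower_bound (s3 sigma : R) : 0 < s3 -> s3 < 1 -> 0 < sigma ->
  log_lower_bound g s3 ->
  exists2 a, 1 <= a & exists2 t', 0 < t' &
    forall x, a <= ln (enorm x) -> fund_log t' sigma x <= u x.
Proof.
move=> s30 s31 sig0 /(_ t t0)/liminf_gt_near[c [b [c0 b1 cb]]].
have [||a' a'1 [t' t'0 tu]] :=
    @log_growth R N N3 u uC2 u_gt0 (c / t) s3 sigma b _ s30 s31 sig0 b1.
- by rewrite divr_gt0.
- move=> x bx.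
  have x1 : 1 <= ln (enorm x) by rewrite (le_trans b1)// ltW.
  have x0 := enorm_gt0_of_ln x1.
  have l0 : 0 < ln (enorm x) by exact: lt_le_trans x1.
  have f0 := fund_gt0 t0 x0.
  apply: (@le_trans _ _ (g x (fund t x) (fund t x) / fund t x * u x * enorm x ^+ 2)).
    rewrite [leRHS]mulrAC ler_pM2r ?u_gt0// quotient_fund//.
    rewrite powRN mulrAC ler_pM2r ?invr_gt0// ler_pdivrMr ?powR_gt0//.
    exact: cb.
  rewrite ler_wpM2r ?exprn_ge0 ?sqrtr_ge0// superlinear// f0 ?fund_u ?fund_v//.
exists a' => //; exists t' => // x ax; rewrite fund_logE ?tu//.
by apply: enorm_gt0_of_ln; exact: le_trans ax.
Qed.

End Component.

Lemma quotient_fund_log t sigma x (y : R) : 0 < t -> 1 <= ln (enorm x) ->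
  y / (t * enorm x ^- N * ln (enorm x) `^ sigma) =
  y / fund_log t sigma x * enorm x ^+ 2.
Proof.
move=> t0 x1; have x0 := enorm_gt0_of_ln x1.
have e0 : enorm x ^+ (N - 2) != 0 by rewrite gt_eqF// exprn_gt0.
have l0 : ln (enorm x) `^ sigma != 0.
  by rewrite gt_eqF// powR_gt0//; exact: lt_le_trans x1.
by rewrite /fund_log /fund enormXN; field; rewrite e0 l0 !gt_eqF.
Qed.

End Growth.

(** * Nonexistence for the system *)

Unset Implicit Arguments.

Theorem theorem1p2 (R : realType) (N : nat) (hN : (3 <= N)%N)
  (Omega : set 'rV[R]_N) (hOmega : punctured_or_exterior_domain Omega)
  (hsub : outside_ball (expR 1) `<=` Omega)
  (h1 h2 : nonlinearity R N)
  (hcond : exists g1 g2 : nonlinearity R N,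
    [/\ nonneg_minorant h1 g1, nonneg_minorant h2 g2, cond_a g1 g2 &
        cond_b g1 g2 \/
        exists sigma3 sigma4 : R,
          [/\ cond_b1 g1 g2 sigma3 sigma4, cond_b2 g1 g2 sigma3 sigma4 &
              cond_b3 g1 g2 sigma3 sigma4]]) :
  ~ exists u v : 'rV[R]_N -> R, positive_supersolution Omega h1 h2 u v.
Proof.
case: hcond => g1 [g2 [hg1 hg2 ga cond]] [u [v [uC vC uv]]].
have out (x : 'rV[R]_N) : 1 <= ln (enorm x) -> outside_ball (expR 1) x.
  by rewrite expR1_le_enorm.
have uC2 := Ck_subset hsub uC.
have vC2 := Ck_subset hsub vC.
have u_gt0 (x : 'rV[R]_N) : 1 <= ln (enorm x) -> 0 < u x by move=> /out/hsub/uv[].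
have v_gt0 (x : 'rV[R]_N) : 1 <= ln (enorm x) -> 0 < v x by move=> /out/hsub/uv[].
have g1u (x : 'rV[R]_N) : 1 <= ln (enorm x) -> g1 x (u x) (v x) <= - laplacian u x.
  move=> x1; have [_ _ + _] := uv x (hsub _ (out _ x1)); apply: le_trans.
  by case: (hg1 x (u x) (v x) (out _ x1) (ltW (u_gt0 _ x1)) (ltW (v_gt0 _ x1))).
have g2v (x : 'rV[R]_N) : 1 <= ln (enorm x) -> g2 x (u x) (v x) <= - laplacian v x.
  move=> x1; have [_ _ _] := uv x (hsub _ (out _ x1)); apply: le_trans.
  by case: (hg2 x (u x) (v x) (out _ x1) (ltW (u_gt0 _ x1)) (ltW (v_gt0 _ x1))).
have g1_ge0 (x : 'rV[R]_N) (s t : R) :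
    1 <= ln (enorm x) -> 0 <= s -> 0 <= t -> 0 <= g1 x s t.
  by move=> x1 s0 t0; case: (hg1 x s t (out _ x1) s0 t0).
pose g2' : nonlinearity R N := fun x s t => g2 x t s.
have g2_ge0 (x : 'rV[R]_N) (s t : R) :
    1 <= ln (enorm x) -> 0 <= s -> 0 <= t -> 0 <= g2' x s t.
  by move=> x1 s0 t0; case: (hg2 x t s (out _ x1) t0 s0).
have sl1 (x : 'rV[R]_N) : 1 <= ln (enorm x) -> forall p q, 0 < p <= u x -> 0 < q <= v x ->
    g1 x p q / p * u x <= - laplacian u x.
  move=> x1 p q /andP[p0 pu] /andP[q0 qv]; apply: le_trans (g1u _ x1).
  have [_ _ /(_ (u x) p (v x) q pu p0 qv q0)[+ _]] := ga x (out _ x1).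
  by rewrite ler_pdivlMr// u_gt0.
have sl2 (x : 'rV[R]_N) : 1 <= ln (enorm x) -> forall q p, 0 < q <= v x -> 0 < p <= u x ->
    g2' x q p / q * v x <= - laplacian v x.
  move=> x1 q p /andP[q0 qv] /andP[p0 pu]; apply: le_trans (g2v _ x1).
  have [_ _ /(_ (u x) p (v x) q pu p0 qv q0)[_]] := ga x (out _ x1).
  by rewrite ler_pdivlMr// v_gt0.
have super_u (x : 'rV[R]_N) : 1 <= ln (enorm x) -> 0 <= - laplacian u x.
  by move=> x1; apply: le_trans (g1u _ x1); rewrite g1_ge0// ltW ?u_gt0 ?v_gt0.
have super_v (x : 'rV[R]_N) : 1 <= ln (enorm x) -> 0 <= - laplacian v x.
  by move=> x1; apply: le_trans (g2v _ x1); rewrite g2_ge0// ltW ?u_gt0 ?v_gt0.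
have [tu tu0 tuP] := superharmonic_lower_bound hN uC2 u_gt0 super_u.
have [tv tv0 tvP] := superharmonic_lower_bound hN vC2 v_gt0 super_v.
(* One constant t <= 1 serves for both components. *)
have [t [t0 t1 ttu ttv]] : exists t : R, [/\ 0 < t, t <= 1, t <= tu & t <= tv].
  exists (Num.min 1 (Num.min tu tv)).
  by rewrite !lt_min ltr01 tu0 tv0 !ge_min !lexx !orbT.
have fu (x : 'rV[R]_N) : 1 <= ln (enorm x) -> fund t x <= u x.
  by move=> x1; apply: le_trans (tuP _ x1); rewrite -!fund_log0 fund_log_le.
have fv (x : 'rV[R]_N) : 1 <= ln (enorm x) -> fund t x <= v x.
  by move=> x1; apply: le_trans (tvP _ x1); rewrite -!fund_log0 fund_log_le.
case: cond => [/(_ t t0)[lim|lim]|[s3 [s4 [[s30 s40 s34 low1 low2] [c21 c22] c3]]]].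
- exact: (absurd_of_cond_b hN uC2 u_gt0 g1_ge0 sl1 t0 fu fv t1 lim).
- exact: (absurd_of_cond_b hN vC2 v_gt0 g2_ge0 sl2 t0 fv fu t1 lim).
have growth_u := log_growth_of_log_lower_bound hN uC2 u_gt0 sl1 t0 fu fv.
have growth_v := log_growth_of_log_lower_bound hN vC2 v_gt0 sl2 t0 fv fu.
have [s31|s31] := ltP s3 1; have [s41|s41] := ltP s4 1.
- have [s5 [s6 [s50 s60 lim]]] := c3 s31 s41.
  have [a a1 [t1' t1'0 ut]] := growth_u s3 s5 s30 s31 s50 low1.
  have [b b1 [t2' t2'0 vt]] := growth_v s4 s6 s40 s41 s60 low2.
  have [r [r0 r1 r2]] : exists r : R, [/\ 0 < r, r <= t1' & r <= t2'].
    by exists (Num.min t1' t2'); rewrite lt_min t1'0 t2'0 !ge_min !lexx orbT.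
  have m1 : 1 <= Num.max a b by rewrite le_max a1.
  have bounds x : Num.max a b <= ln (enorm x) ->
      [/\ 1 <= ln (enorm x), 0 < fund_log r s5 x <= u x
        & 0 < fund_log r s6 x <= v x].
    rewrite ge_max => /andP[ax bx].
    have x1 : 1 <= ln (enorm x) by exact: le_trans ax.
    rewrite !fund_log_gt0//=; split=> //.
      by apply: le_trans (ut _ ax); exact: fund_log_le.
    by apply: le_trans (vt _ bx); exact: fund_log_le.
  case: (lim r r0) => {}lim.
    apply: (absurd_of_hardy_liminf hN uC2 u_gt0 sl1 m1 lim
      (p := fund_log r s5) (q := fund_log r s6)) => x mx.
    by have [x1 ? ?] := bounds x mx; rewrite quotient_fund_log.
  apply: (absurd_of_hardy_liminf hN vC2 v_gt0 sl2 m1 lim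
    (p := fund_log r s6) (q := fund_log r s5)) => x mx.
  by have [x1 ? ?] := bounds x mx; rewrite quotient_fund_log.
- have [s5 s50 lim] := c21 s31 s41.
  have [a a1 [t' t'0 ut]] := growth_u s3 s5 s30 s31 s50 low1.
  have [r [r0 r1 r2]] : exists r : R, [/\ 0 < r, r <= t' & r <= t].
    by exists (Num.min t' t); rewrite lt_min t'0 t0 !ge_min !lexx orbT.
  apply: (absurd_of_hardy_liminf hN uC2 u_gt0 sl1 a1 (lim r r0)
    (p := fund_log r s5) (q := fund r)) => x ax.
  have x1 : 1 <= ln (enorm x) by exact: le_trans ax.
  rewrite quotient_fund_log// fund_log_gt0// fund_gt0 ?enorm_gt0_of_ln//; split=> //=.
    by apply: le_trans (ut _ ax); exact: fund_log_le.
  by apply: le_trans (fv _ x1); rewrite -!fund_log0 fund_log_le.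
- have [s6 s60 lim] := c22 s31 s41.
  have [a a1 [t' t'0 vt]] := growth_v s4 s6 s40 s41 s60 low2.
  have [r [r0 r1 r2]] : exists r : R, [/\ 0 < r, r <= t' & r <= t].
    by exists (Num.min t' t); rewrite lt_min t'0 t0 !ge_min !lexx orbT.
  apply: (absurd_of_hardy_liminf hN vC2 v_gt0 sl2 a1 (lim r r0)
    (p := fund_log r s6) (q := fund r)) => x ax.
  have x1 : 1 <= ln (enorm x) by exact: le_trans ax.
  rewrite quotient_fund_log// fund_log_gt0// fund_gt0 ?enorm_gt0_of_ln//; split=> //=.
    by apply: le_trans (vt _ ax); exact: fund_log_le.
  by apply: le_trans (fu _ x1); rewrite -!fund_log0 fund_log_le.
- by case: s34; rewrite ltNge ?s31 ?s41.
Qed.
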